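(* Let $1\leq j<k<\omega$, let $l_0<\dots<l_{j-1}<k-1$ and $E=\{l_i:i<j\}$. Let $\{A_{\bar n}:\bar n\in\omega^j\}\subseteq[\omega]^\omega$. For $\bar m\in\omega^E$ let $$B_{\bar m}=\bigcap_{i_0\leq\bar m(l_0)}\ \bigcup_{i_1\leq\bar m(l_1)}\ \bigcap_{i_2\leq\bar m(l_2)}\cdots A_{(i_0,\dots,i_{j-1})}$$ (the operations alternate, starting with $\bigcap$, with $j$ operations in total). Then in $\mathcal{P}(\omega^k)/\mathcal{NC}^k$ the following equality holds (in particular the right-hand side exists): $$\coprod_{\bar m\in\omega^E}B_{\bar m}=\bigwedge_{n_0<\omega}\ \bigvee_{n_1<\omega}\ \bigwedge_{n_2<\omega}\cdots\ \omega^{k-1}\times A_{(n_0,\dots,n_{j-1})},$$ where the operations on the right alternate in the same pattern, starting with $\bigwedge$, with $j$ operations in total.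
   Context: The ideals $\mathrm{fin}^k$ on $\omega^k$: $\mathrm{fin}^1$ is the ideal of finite subsets of $\omega$, and for $k>1$, $\mathrm{fin}^k=\{A\subseteq\omega^k: A(n)\in\mathrm{fin}^{k-1}\text{ for all but finitely many } n\}$, where $A(n)=\{\bar x\in\omega^{k-1}:(n)^\frown\bar x\in A\}$; $A\subseteq_{\mathrm{fin}^k}B$ means $A\setminus B\in\mathrm{fin}^k$. For $k\geq2$, $\mathcal{NC}^k=\{A\subseteq\omega^k:\ \text{for all }(A_0,\dots,A_{k-2})\in([\omega]^\omega)^{k-1},\ \text{for all but finitely many } n,\ \prod_{i<k-1}A_i\not\subseteq_{\mathrm{fin}^{k-1}}A(n)\}$, an ideal on $\omega^k$; $\mathcal{P}(\omega^k)/\mathcal{NC}^k$ is the quotient Boolean algebra. Notation: for $E\subseteq k-1$ and sets $B_{\bar m}\subseteq\omega$ ($\bar m\in\omega^E$), $\coprod_{\bar m\in\omega^E}B_{\bar m}=\{\bar x\in\omega^k:\bar x(k-1)\in B_{\bar x\upharpoonright E}\}$. *)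

(* Defs.v *)
From HB Require Import structures.
From mathcomp Require Import all_boot all_order.
From mathcomp Require Import all_classical.

Set Implicit Arguments.
Unset Strict Implicit.
Unset Printing Implicit Defensive.

Import Order.TTheory.
Local Open Scope classical_set_scope.
Local Open Scope quotient_scope.

(* Ideals are not required to be proper. *)
Record ideal (T : Type) := Ideal {
  ideal_set :> set T -> Prop;
  ideal0 : ideal_set set0;
  idealS : forall A B, A `<=` B -> ideal_set B -> ideal_set A;
  idealU : forall A B, ideal_set A -> ideal_set B -> ideal_set (A `|` B) }.

Section PowerQuotient.
Context (T : Type) (J : ideal T).
Implicit Types A B C : set T.

Definition ideal_eq : rel (set T) := fun A B => `[< J (A `+` B) >].

Fact ideal_eq_refl : reflexive ideal_eq.
Proof. by move=> A; apply/asboolP; rewrite setYK; exact: ideal0. Qed.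

Fact ideal_eq_sym : symmetric ideal_eq.
Proof. by move=> A B; rewrite /ideal_eq setYC. Qed.

Fact ideal_eq_trans : transitive ideal_eq.
Proof.
move=> B A C /asboolP AB /asboolP BC; apply/asboolP.
apply: idealS (idealU AB BC) => x; rewrite /setY /= => -[] [].
  by move=> Ax nCx; have [Bx|nBx] := pselect (B x); [right; left|left; left].
by move=> Cx nAx; have [Bx|nBx] := pselect (B x); [left; right|right; right].
Qed.

Canonical ideal_equiv :=
  EquivRel ideal_eq ideal_eq_refl ideal_eq_sym ideal_eq_trans.

Definition power_quot := {eq_quot ideal_equiv}.
HB.instance Definition _ := Choice.on power_quot.
HB.instance Definition _ := EqQuotient.on power_quot.

Definition pclass : set T -> power_quot := \pi_power_quot.

Implicit Types x y z : power_quot.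

Lemma pclassP A B : pclass A = pclass B <-> J (A `+` B).
Proof.
split=> [AB|AB]; first by apply/asboolP/(@eqmodP _ ideal_equiv).
by apply/(@eqmodP _ ideal_equiv)/asboolP.
Qed.

Lemma pclass_repr x : pclass (repr x) = x.
Proof. exact: reprK. Qed.

Lemma pclass_ind (P : power_quot -> Prop) :
  (forall A, P (pclass A)) -> forall x, P x.
Proof. by move=> H x; rewrite -(pclass_repr x). Qed.

Definition pmeet x y := pclass (repr x `&` repr y).
Definition pjoin x y := pclass (repr x `|` repr y).
Definition pcompl x := pclass (~` repr x).
Definition ple : rel power_quot := fun x y => `[< J (repr x `\` repr y) >].
Definition plt : rel power_quot := fun x y => (y != x) && ple x y.

Lemma repr_pclass A : J (repr (pclass A) `+` A).
Proof. by apply/pclassP; rewrite pclass_repr. Qed.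

Let tauto_set A B C D E F : E `+` F `<=` (A `+` B) `|` (C `+` D) ->
  J (A `+` B) -> J (C `+` D) -> pclass E = pclass F.
Proof. by move=> H AB CD; apply/pclassP; apply: idealS H (idealU AB CD). Qed.

Lemma pmeetE A B : pmeet (pclass A) (pclass B) = pclass (A `&` B).
Proof.
apply: tauto_set (repr_pclass A) (repr_pclass B) => t.
rewrite /setY /=; have := pselect (A t); have := pselect (repr (pclass A) t).
by have := pselect (B t); have := pselect (repr (pclass B) t); tauto.
Qed.

Lemma pjoinE A B : pjoin (pclass A) (pclass B) = pclass (A `|` B).
Proof.
apply: tauto_set (repr_pclass A) (repr_pclass B) => t.
rewrite /setY /=; have := pselect (A t); have := pselect (repr (pclass A) t).
by have := pselect (B t); have := pselect (repr (pclass B) t); tauto.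
Qed.

Lemma pcomplE A : pcompl (pclass A) = pclass (~` A).
Proof.
apply: tauto_set (repr_pclass A) (repr_pclass A) => t.
rewrite /setY /=; have := pselect (A t); have := pselect (repr (pclass A) t).
by tauto.
Qed.

Lemma ple_pclass A B : ple (pclass A) (pclass B) = `[< J (A `\` B) >].
Proof.
have JA := repr_pclass A; have JB := repr_pclass B.
apply/asboolP/asboolP => AB; apply: idealS (idealU AB (idealU JA JB)) => t;
  rewrite /setY /=;
  have := pselect (A t); have := pselect (repr (pclass A) t);
  have := pselect (B t); have := pselect (repr (pclass B) t); tauto.
Qed.

Fact ple_def x y : ple x y = (pmeet x y == x).
Proof.
elim/pclass_ind: x => A; elim/pclass_ind: y => B.
rewrite ple_pclass pmeetE; apply/asboolP/eqP => [AB|/pclassP AB].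
  apply/pclassP; apply: idealS AB => t; rewrite /setY /=.
  by have := pselect (B t); tauto.
by apply: idealS AB => t; rewrite /setY /=; tauto.
Qed.

Fact plt_def x y : plt x y = (y != x) && ple x y. Proof. by []. Qed.

Fact pmeetC : commutative pmeet.
Proof. by move=> x y; rewrite /pmeet setIC. Qed.
Fact pjoinC : commutative pjoin.
Proof. by move=> x y; rewrite /pjoin setUC. Qed.
Fact pmeetA : associative pmeet.
Proof.
by elim/pclass_ind=> A; elim/pclass_ind=> B; elim/pclass_ind=> C;
  rewrite !pmeetE setIA.
Qed.
Fact pjoinA : associative pjoin.
Proof.
by elim/pclass_ind=> A; elim/pclass_ind=> B; elim/pclass_ind=> C;
  rewrite !pjoinE setUA.
Qed.
Fact pjoinKI y x : pmeet x (pjoin x y) = x.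
Proof.
by elim/pclass_ind: x => A; elim/pclass_ind: y => B;
  rewrite pjoinE pmeetE setUC setKU.
Qed.
Fact pmeetKU y x : pjoin x (pmeet x y) = x.
Proof.
by elim/pclass_ind: x => A; elim/pclass_ind: y => B;
  rewrite pmeetE pjoinE setIC setKI.
Qed.
Fact pmeetUl : left_distributive pmeet pjoin.
Proof.
by elim/pclass_ind=> A; elim/pclass_ind=> B; elim/pclass_ind=> C;
  rewrite (pjoinE A B) !pmeetE pjoinE setIUl.
Qed.
Fact pmeetxx : idempotent_op pmeet.
Proof. by elim/pclass_ind=> A; rewrite pmeetE setIid. Qed.

Fact power_quot_display : Order.disp_t. Proof. by []. Qed.

HB.instance Definition _ :=
  Order.isMeetJoinDistrLattice.Build power_quot_display power_quot
    ple_def plt_def pmeetC pjoinC pmeetA pjoinA pjoinKI pmeetKU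
    pmeetUl pmeetxx.

Lemma le_pclass A B : (pclass A <= pclass B)%O = `[< J (A `\` B) >].
Proof. exact: ple_pclass. Qed.

Fact power_quot_le0 x : (pclass set0 <= x)%O.
Proof.
elim/pclass_ind: x => A; rewrite le_pclass set0D.
by apply/asboolP; exact: ideal0.
Qed.

Fact power_quot_le1 x : (x <= pclass setT)%O.
Proof.
elim/pclass_ind: x => A; rewrite le_pclass setDT.
by apply/asboolP; exact: ideal0.
Qed.

HB.instance Definition _ :=
  Order.hasBottom.Build power_quot_display power_quot power_quot_le0.
HB.instance Definition _ :=
  Order.hasTop.Build power_quot_display power_quot power_quot_le1.

Fact pjoinxC x : (x `|` pcompl x)%O = \top%O.
Proof.
elim/pclass_ind: x => A; rewrite pcomplE.
by rewrite -[LHS]/(pjoin _ _) pjoinE setUv.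
Qed.

Fact pmeetxC x : (x `&` pcompl x)%O = \bot%O.
Proof.
elim/pclass_ind: x => A; rewrite pcomplE.
by rewrite -[LHS]/(pmeet _ _) pmeetE setICr.
Qed.

HB.instance Definition _ :=
  Order.TBDistrLattice_hasComplement.Build power_quot_display power_quot
    pjoinxC pmeetxC.

End PowerQuotient.

Arguments pclass {T} J A.

(* The set omega^k is [k.-tuple nat].  [sect A n] is A(n), stated so
   that it makes sense for every k (it is empty for k = 0). *)
Definition sect (k : nat) (A : set (k.-tuple nat)) (n : nat) :
    set (k.-1.-tuple nat) :=
  [set y | exists2 x, A x & tval x = n :: tval y].

(* The value {set0} at k = 0 is a convention. *)
Fixpoint finpow (k : nat) : set (k.-tuple nat) -> Prop :=
  match k return set (k.-tuple nat) -> Prop with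
  | 0 => fun A => A = set0
  | k'.+1 => fun A : set (k'.+1.-tuple nat) =>
      if k' is 0 then finite_set A
      else cofinite_set [set n | finpow (sect A n)]
  end.

Definition sub_finpow (k : nat) (A B : set (k.-tuple nat)) : Prop :=
  finpow (A `\` B).

Definition box (d : nat) (C : 'I_d -> set nat) : set (d.-tuple nat) :=
  [set x | forall i, C i (tnth x i)].

Definition NC (k : nat) (A : set (k.-tuple nat)) : Prop :=
  forall C : 'I_k.-1 -> set nat, (forall i, infinite_set (C i)) ->
    cofinite_set [set n | ~ sub_finpow (box C) (sect A n)].

Lemma sectS k (A B : set (k.-tuple nat)) n :
  A `<=` B -> sect A n `<=` sect B n.
Proof. by move=> AB y [x Ax xy]; exists x => //; exact: AB. Qed.

Lemma sectU k (A B : set (k.-tuple nat)) n :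
  sect (A `|` B) n = sect A n `|` sect B n.
Proof.
apply/seteqP; split=> [y [x [Ax|Bx] xy]|y [[x Ax xy]|[x Bx xy]]].
- by left; exists x.
- by right; exists x.
- by exists x => //; left.
- by exists x => //; right.
Qed.

Lemma sect0 k n : sect (set0 : set (k.-tuple nat)) n = set0.
Proof. by apply/seteqP; split=> [y []|]. Qed.

Lemma sectSE k (A : set (k.+1.-tuple nat)) n (y : k.-tuple nat) :
  sect A n y <-> A [tuple of n :: y].
Proof.
split=> [[x Ax xy]|Ay]; last by exists [tuple of n :: y].
by have -> : [tuple of n :: y] = x by apply: val_inj.
Qed.

Lemma finpowSE k (A : set (k.+1.-tuple nat)) :
  finpow A <-> cofinite_set [set n | finpow (sect A n)].
Proof.
case: k A => [|k] A //; rewrite [X in X <-> _]/=.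
have -> : ~` [set n | finpow (sect A n)] = (fun x : 1.-tuple nat => thead x) @` A.
  apply/seteqP; split=> [n /= /eqP/set0P[y [x Ax xy]]|n [x Ax <-]] /=.
    by exists x => //; rewrite /thead (tnth_nth 0) xy.
  apply/eqP/set0P; exists [tuple of behead x]; exists x => //=.
  by rewrite [in LHS](tuple_eta x).
split; first exact: finite_image.
move=> /(finite_image (fun n => [tuple n])); apply: sub_finite_set.
move=> x Ax; exists (thead x); first by exists x.
by rewrite [RHS]tuple_eta; apply: val_inj => /=; case: x {Ax} => [[|? []]].
Qed.

Lemma finpow0 k : finpow (set0 : set (k.-tuple nat)).
Proof.
elim: k => [|k IH]; first by [].
apply/finpowSE; rewrite (_ : [set n | _] = setT) ?setCT //.
by apply/seteqP; split=> n //= _; rewrite sect0.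
Qed.

Lemma finpowS k (A B : set (k.-tuple nat)) : A `<=` B -> finpow B -> finpow A.
Proof.
elim: k A B => [|k IH] A B AB.
  by move=> /= B0; apply/seteqP; split=> // x /AB; rewrite B0.
move=> /finpowSE fB; apply/finpowSE; apply: sub_finite_set fB.
by move=> n /= nA nB; apply: nA; apply: IH nB; exact: (@sectS k.+1).
Qed.

Lemma finpowU k (A B : set (k.-tuple nat)) :
  finpow A -> finpow B -> finpow (A `|` B).
Proof.
elim: k A B => [|k IH] A B; first by move=> /= -> ->; rewrite setU0.
move=> /finpowSE fA /finpowSE fB; apply/finpowSE.
have : finite_set (~` [set n | finpow (sect A n)] `|`
                   ~` [set n | finpow (sect B n)]) by rewrite finite_setU.
apply: sub_finite_set => n /= nAB; apply: contrapT => /not_orP[].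
move=> /contrapT fAn /contrapT fBn; apply: nAB.
by rewrite sectU; exact: IH.
Qed.

Lemma infinite_natP (A : set nat) :
  infinite_set A <-> forall N, exists2 n, (N <= n)%N & A n.
Proof.
split=> [iA N|H fA].
  apply: contrapT => nA; apply: iA.
  apply: (@sub_finite_set _ _ `I_N) (finite_II N) => n An /=.
  by rewrite ltnNge; apply/negP => Nn; apply: nA; exists n.
have /finite_seqP[X AX] := fA.
have [n nX An] := H (\max_(x <- X) x).+1.
have {}An : n \in X by move: An; rewrite AX.
by have := @leq_bigmax_seq _ X xpredT id n An isT; rewrite leqNgt nX.
Qed.

Lemma infinite_seq_decide (S : nat -> set nat) (C : set nat) :
  infinite_set C -> exists C' : set nat,
  [/\ infinite_set C', C' `<=` C
    & forall n, finite_set (C' `\` S n) \/ finite_set (C' `&` S n)].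
Proof.
move=> iC.
pose D := fix D n := if n is n'.+1 then
  (if `[< infinite_set (D n' `&` S n') >] then D n' `&` S n'
   else D n' `\` S n') else C.
have iD n : infinite_set (D n).
  elim: n => //= n IH; case: asboolP => // /contrapT fD fD'; apply: IH.
  by rewrite -(setUIDK (D n) (S n)) finite_setU.
have DS n : D n.+1 `<=` D n by move=> x /=; case: asboolP => _ [].
have Dle m n : (m <= n)%N -> D n `<=` D m.
  elim: n => [|n IH]; first by rewrite leqn0 => /eqP->.
  by rewrite leq_eqVlt => /orP[/eqP->//|/IH]; apply: subset_trans; exact: DS.
have /choice[pick pickP] : forall p : nat * nat,
    exists n, (p.2 <= n)%N /\ D p.1 n.
  by move=> [m N]; have /infinite_natP/(_ N)[n] := iD m; exists n.
pose c := fix c n := if n is n'.+1 then pick (n, (c n').+1) else pick (0, 0).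
have cS n : (c n < c n.+1)%N by have [] := pickP (n.+1, (c n).+1).
have cD n : D n (c n).
  by case: n => [|n]; [have [] := pickP (0, 0)|have [] := pickP (n.+1, (c n).+1)].
have cn n : (n <= c n)%N by elim: n => // n IH; exact: leq_ltn_trans (cS n).
exists (range c); split.
- by apply/infinite_natP => N; exists (c N) => //; exists N.
- by move=> _ [n _ <-]; exact: (@Dle 0 n (leq0n n)).
- move=> n; pose F := c @` `I_n.+1.
  have fF : finite_set F by apply: finite_image; exact: finite_II.
  have cF m : ~ F (c m) -> D n.+1 (c m).
    move=> nF; apply: (@Dle n.+1 m) => //; rewrite ltnNge; apply/negP => mn.
    by apply: nF; exists m.
  have [DI|DD] : D n.+1 `<=` S n \/ D n.+1 `<=` ~` S n.
    by rewrite /=; case: asboolP => _; [left|right] => x [].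
  - left; apply: sub_finite_set fF => _ [[m _ <-] Sm].
    by apply: contrapT => /cF/DI.
  - right; apply: sub_finite_set fF => _ [[m _ <-] Sm].
    by apply: contrapT => /cF/DD.
Qed.

Lemma box_decide d (S : nat -> set (d.-tuple nat)) (C : 'I_d -> set nat) :
  (forall i, infinite_set (C i)) -> exists C' : 'I_d -> set nat,
  [/\ forall i, infinite_set (C' i), forall i, C' i `<=` C i
    & forall n, finpow (box C' `\` S n) \/ finpow (box C' `&` S n)].
Proof.
elim: d S C => [|d IH] S C iC.
  exists C; split=> [//|i|n]; first exact: subset_refl.
  have [Sn|nSn] := pselect (S n [tuple]).
    by left; rewrite /= -subset0 => x -[_]; rewrite (tuple0 x).
  by right; rewrite /= -subset0 => x -[_]; rewrite (tuple0 x).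
pose S' p := if unpickle p is Some q then sect (S q.1) q.2 else set0.
have [C1 [iC1 C1C dec1]] := IH S' (fun i => C (lift ord0 i)) (fun i => iC _).
pose U n := [set m | finpow (box C1 `\` sect (S n) m)].
have [C0 [iC0 C0C dec0]] := infinite_seq_decide U (iC ord0).
pose C' i := if unlift ord0 i is Some i' then C1 i' else C0.
have sbox (X : set (d.+1.-tuple nat)) m y :
    sect (box C' `&` X) m y -> [/\ C0 m, box C1 y & sect X m y].
  move=> [x [bx Xx] xy]; split; last by exists x.
    by have := bx ord0; rewrite /C' unlift_none (tnth_nth 0) xy.
  move=> i; have := bx (lift ord0 i); rewrite /C' liftK !(tnth_nth 0) xy.
  by rewrite lift0.
exists C'; split.
- by move=> i; rewrite /C'; case: unliftP.
- by move=> i; rewrite /C'; case: unliftP => [i'|] ->.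
- have sect_sub (X : set (d.+1.-tuple nat)) m :
      ~ finpow (sect (box C' `&` X) m) -> C0 m /\ ~ finpow (box C1 `&` sect X m).
    move=> nf; split; last first.
      by apply: contra_not nf; apply: finpowS => y /sbox[].
    apply: contrapT => nC0; apply: nf.
    by apply: finpowS (finpow0 _) => y /sbox[].
  have sectC n m : box C1 `&` sect (~` S n) m `<=` box C1 `\` sect (S n) m.
    by move=> y [Cy /sectSE nS]; split=> // /sectSE.
  move=> n; case: (dec0 n) => fU; [left|right]; apply/finpowSE;
    apply: sub_finite_set fU => m /sect_sub[C0m nf]; split=> //.
    by apply: contra_not nf; apply: finpowS; exact: sectC.
  by have := dec1 (pickle (n, m)); rewrite /S' pickleK /=; case.
Qed.

Lemma box_notin_finpow d (C : 'I_d -> set nat) :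
  (forall i, infinite_set (C i)) -> ~ finpow (box C).
Proof.
elim: d C => [|d IH] C iC.
  by move=> /seteqP[/(_ [tuple])] + _; apply; case.
move=> /finpowSE; apply: (@sub_infinite_set _ (C ord0)) (iC ord0).
move=> n Cn /= f; apply: (IH (fun i => C (lift ord0 i))) => //.
apply: finpowS f => y Cy; apply/sectSE => i.
case: (unliftP ord0 i) => [i'|] ->; last by rewrite tnth0.
by rewrite tnthS.
Qed.

Lemma NC0 k : NC (set0 : set (k.-tuple nat)).
Proof.
move=> C iC; rewrite (_ : [set n | _] = setT) ?setCT //.
apply/seteqP; split=> n //= _; rewrite /sub_finpow sect0 setD0.
exact: box_notin_finpow.
Qed.

Lemma NCS k (A B : set (k.-tuple nat)) : A `<=` B -> NC B -> NC A.
Proof.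
move=> AB NB C iC; apply: sub_finite_set (NB C iC) => n /= /contrapT f /(_ _).
apply; apply: finpowS f => y [Cy nBy]; split=> // /(sectS AB).
exact: nBy.
Qed.

Lemma NCU k (A B : set (k.-tuple nat)) : NC A -> NC B -> NC (A `|` B).
Proof.
move=> NA NB C iC; have [C' [iC' C'C dec]] := box_decide (sect A) iC.
have : finite_set (~` [set n | ~ sub_finpow (box C') (sect A n)] `|`
                   ~` [set n | ~ sub_finpow (box C') (sect B n)]).
  by rewrite finite_setU; split; [exact: NA|exact: NB].
apply: sub_finite_set => n /= /contrapT; rewrite /sub_finpow sectU => f.
have {}f : finpow (box C' `\` (sect A n `|` sect B n)).
  by apply: finpowS f => y [Cy nS]; split=> // i; apply: C'C.
have [fA|fA] := dec n; [left|right]; apply; first exact: fA.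
apply: finpowS (finpowU f fA) => y [Cy nB].
by have [Ay|nAy] := pselect (sect A n y); [right|left; split=> // -[]].
Qed.

Definition NC_ideal (k : nat) : ideal (k.-tuple nat) :=
  Ideal (@NC0 k) (@NCS k) (@NCU k).

(* The flag [b] tells whether the outermost operation is an intersection
   (resp. an infimum) or a union (resp. a supremum). *)
Fixpoint alt_bounded (b : bool) (j : nat) :
    j.-tuple nat -> (j.-tuple nat -> set nat) -> set nat :=
  match j return j.-tuple nat -> (j.-tuple nat -> set nat) -> set nat with
  | 0 => fun _ A => A [tuple]
  | j'.+1 => fun m A =>
      let F i := alt_bounded (~~ b) [tuple of behead m]
                   (fun s : j'.-tuple nat => A [tuple of i :: s]) in
      if b then \bigcap_(i in [set i | (i <= thead m)%N]) F i
      else \bigcup_(i in [set i | (i <= thead m)%N]) F i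
  end.

(* [alt_value b F v]: the alternating infinitary expression in [F], all of
   whose subexpressions are required to exist, has value [v]. *)
Fixpoint alt_value (d : Order.disp_t) (T : porderType d) (b : bool) (j : nat) :
    (j.-tuple nat -> T) -> T -> Prop :=
  match j return (j.-tuple nat -> T) -> T -> Prop with
  | 0 => fun F v => v = F [tuple]
  | j'.+1 => fun F v => exists G : nat -> T,
      (forall n, alt_value (~~ b)
         (fun s : j'.-tuple nat => F [tuple of n :: s]) (G n)) /\
      (if b then infimums (range G) v else supremums (range G) v)
  end.

(* For [E : set 'I_k.-1], seen as a type, omega^E is [E -> nat]. *)
Definition restr (k : nat) (E : set 'I_k.-1) (x : k.-tuple nat) : E -> nat :=
  fun e => nth 0 x (val e).

Definition coprod (k : nat) (E : set 'I_k.-1) (B : (E -> nat) -> set nat) :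
    set (k.-tuple nat) :=
  [set x | B (restr x) (nth 0 x k.-1)].

(* omega^(k-1) x A *)
Definition cylinder (k : nat) (A : set nat) : set (k.-tuple nat) :=
  [set x | A (nth 0 x k.-1)].

Definition range_elt (I : Type) (T : Type) (l : I -> T) (i : I) : range l :=
  SigSub (mem_set (imageT l i)).

(* Main.v *)
(** Write [W] for the set of [x] lying in [V i] for all [i <= x p], where the
    sets [V i] depend only on the coordinates beyond [p].  The point is that
    the class of [W] is the infimum of the classes of the [V i]; the theorem
    follows by induction on the number of operations, suprema being handled by
    complementation.  Clearly [W `\` V n] lies in the slab [x p < n], which is
    small.  Conversely let [X `\` V n] be small for all [n], and suppose that a
    box [C] is almost contained in infinitely many sections of [X `\` W].
    Shrink [C] so that it decides every [V i] (whose sections do not depend on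
    the first coordinate).  If [C] is almost disjoint from some [V i], it is
    almost contained in infinitely many sections of [X `\` V i], a
    contradiction.  Otherwise [C] is almost contained in every [V i], and then
    almost disjoint from the complement of [W], because for fixed [x p] only
    finitely many [i] matter: again a contradiction. *)
Require Import Defs.
From mathcomp Require Import all_boot all_order.
From mathcomp Require Import all_classical.

Set Implicit Arguments.
Unset Strict Implicit.
Unset Printing Implicit Defensive.

Local Open Scope classical_set_scope.

(** * Sets that depend only on later coordinates *)

Definition beyond (k : nat) (p : nat) (D : set (k.-tuple nat)) : Prop :=
  forall x y : k.-tuple nat,
    (forall i, (p < i)%N -> nth 0 x i = nth 0 y i) -> D x -> D y.

Lemma beyondC k p (D : set (k.-tuple nat)) : beyond p D -> beyond p (~` D).
Proof.
by move=> bD x y xy nDx Dy; apply/nDx/(bD y) => // i pi; rewrite xy.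
Qed.

Lemma sect_beyond k p (D : set (k.+1.-tuple nat)) m n :
  beyond p D -> sect D m = sect D n.
Proof.
move=> bD; apply/seteqP; split=> y /sectSE Dy; apply/sectSE;
  by apply: bD Dy => -[|i].
Qed.

Lemma beyond_sect k p (D : set (k.+1.-tuple nat)) n :
  beyond p.+1 D -> beyond p (sect D n).
Proof.
move=> bD x y xy /sectSE Dx; apply/sectSE; apply: bD Dx => -[|i] //=.
by rewrite ltnS; exact: xy.
Qed.

Lemma sect_box k (C : 'I_k.+1 -> set nat) (D : set (k.+1.-tuple nat)) n :
  C ord0 n ->
  sect (box C `&` D) n = box (fun i => C (lift ord0 i)) `&` sect D n.
Proof.
move=> Cn; apply/seteqP; split=> [y /sectSE[Cy Dy]|y [Cy /sectSE Dy]].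
  split; last exact/sectSE.
  by move=> i; have := Cy (lift ord0 i); rewrite tnthS.
apply/sectSE; split=> // i.
by case: (unliftP ord0 i) => [i'|] ->; rewrite ?tnth0 ?tnthS.
Qed.

Lemma sect_box_notin k (C : 'I_k.+1 -> set nat) (D : set (k.+1.-tuple nat)) n :
  ~ C ord0 n -> sect (box C `&` D) n = set0.
Proof.
by move=> nCn; rewrite -subset0 => y /sectSE[/(_ ord0)]; rewrite tnth0.
Qed.

Lemma finpow_bounded_union k (D : nat -> set (k.-tuple nat)) n :
  (forall i, finpow (D i)) -> finpow [set x | exists2 i, (i <= n)%N & D i x].
Proof.
move=> fD; elim: n => [|n IH].
  by apply: finpowS (fD 0) => x [i]; rewrite leqn0 => /eqP->.
apply: finpowS (finpowU IH (fD n.+1)) => x [i].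
by rewrite leq_eqVlt ltnS => /orP[/eqP->|]; [right|left; exists i].
Qed.

(** All sections of [D] coincide, so it suffices that one section over the infinite side [C ord0] is
    small; [n] itself may lie outside that side. *)
Lemma finpow_sect_beyond k p (C : 'I_k.+1 -> set nat)
    (D : set (k.+1.-tuple nat)) n :
  infinite_set (C ord0) -> beyond p D -> finpow (box C `&` D) ->
  finpow (box (fun i => C (lift ord0 i)) `&` sect D n).
Proof.
move=> iC bD /finpowSE fD.
have [m [Cm /= fm]] :
    exists m, C ord0 m /\ [set m | finpow (sect (box C `&` D) m)] m.
  apply: contrapT => nm; apply: iC; apply: sub_finite_set fD => m Cm fm.
  by apply: nm; exists m.
by move: fm; rewrite sect_box // (sect_beyond m n bD).
Qed.

(** Passing to sections lowers [p] until it is the first coordinate. There the section at [n] fixes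
    the bound to be [n], and the union becomes finite. *)
Lemma finpow_coord_union k p (C : 'I_k -> set nat)
    (D : nat -> set (k.-tuple nat)) :
  (p < k)%N -> (forall i, infinite_set (C i)) -> (forall i, beyond p (D i)) ->
  (forall i, finpow (box C `&` D i)) ->
  finpow (box C `&` [set x : k.-tuple nat | exists2 i, (i <= nth 0 x p)%N & D i x]).
Proof.
elim: k p C D => // k IH p C D pk iC bD fD; apply/finpowSE.
rewrite [X in cofinite_set X](_ : _ = setT) ?setCT // -subTset => n _ /=.
have [Cn|nCn] := pselect (C ord0 n); last first.
  by rewrite sect_box_notin //; exact: finpow0.
rewrite sect_box //.
have fDn i := finpow_sect_beyond n (iC ord0) (bD i) (fD i).
case: p pk bD => [|p] pk bD.
  apply: finpowS (finpow_bounded_union n fDn) => y [Cy /sectSE[i /= iN Di]].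
  by exists i => //; split=> //; exact/sectSE.
apply: finpowS (IH p _ (fun i => sect (D i) n) pk _ _ fDn) => //.
- by move=> y [Cy /sectSE[i /= iN Di]]; split=> //; exists i => //; exact/sectSE.
- by move=> i; exact: beyond_sect.
Qed.

(** * Slabs and coordinate-bounded intersections modulo [NC] *)

(** Deleting the values below [N] from every side leaves a box with infinite sides that misses the
    slab. *)
Lemma box_setD_slab_notin_finpow k p (C : 'I_k -> set nat) N :
  (p < k)%N -> (forall i, infinite_set (C i)) ->
  ~ finpow (box C `\` [set x : k.-tuple nat | (nth 0 x p < N)%N]).
Proof.
move=> pk iC; pose C' i := C i `&` [set n | (N <= n)%N].
have iC' i : infinite_set (C' i).
  apply/infinite_natP => M; have /infinite_natP/(_ (maxn M N))[n] := iC i.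
  by rewrite geq_max => /andP[Mn Nn] Cn; exists n.
apply: contra_not (box_notin_finpow iC'); apply: finpowS => x C'x; split.
  by move=> i; have [] := C'x i.
have [_ /=] := C'x (Ordinal pk); rewrite (tnth_nth 0) /= leqNgt.
by move=> /negP.
Qed.

(** For [p = 0] the sections from [N] on are empty. For [p > 0] every section is a slab one
    dimension lower, which almost contains no box with infinite sides. *)
Lemma NC_slab k p N :
  (p < k)%N -> NC [set x : k.-tuple nat | (nth 0 x p < N)%N].
Proof.
case: k p => // k [|p] pk C iC.
  apply: sub_finite_set (finite_II N) => n /= /contrapT fn.
  apply: contrapT => /negP; rewrite -leqNgt => Nn.
  apply: (box_notin_finpow iC); apply: finpowS fn => y Cy; split=> //.
  by move=> /sectSE /=; rewrite ltnNge Nn.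
apply: (@sub_finite_set _ _ set0) => // n /= /contrapT fn.
apply: (@box_setD_slab_notin_finpow _ p C N pk iC).
by apply: finpowS fn => y [Cy nN]; split=> // /sectSE.
Qed.

Lemma NC_setD_coord_inter k p (V : nat -> set (k.-tuple nat))
    (X : set (k.-tuple nat)) :
  (p < k)%N -> (forall i, beyond p (V i)) ->
  (forall n, NC (X `\` V n)) ->
  NC (X `\` [set x : k.-tuple nat | forall i, (i <= nth 0 x p)%N -> V i x]).
Proof.
case: k V X => // k V X pk bV NV C iC; set W := [set x | forall i, _].
(* The index 0 is arbitrary: [V i] has the same section everywhere. *)
have [C' [iC' C'C dec]] := box_decide (fun i => sect (V i) 0) iC.
have [[i0 fi0]|nfi] :=
    pselect (exists i, finpow (box C' `&` sect (V i) 0)).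
  apply: sub_finite_set (NV i0 C' iC') => n /= /contrapT fn; apply.
  apply: finpowS (finpowU fn fi0) => y [C'y /sectSE nXV].
  have [Vy|nVy] := pselect (sect (V i0) 0 y); [by right|left; split].
    by move=> i; apply: C'C.
  move=> /sectSE[Xy nWy]; apply: nXV; split=> // Vy; apply: nVy.
  by rewrite (sect_beyond 0 n (bV i0)); apply/sectSE.
have fV i : finpow (box C' `\` sect (V i) 0).
  by have [//|fi] := dec i; case: nfi; exists i.
(* A full first side is added because [p] may be the first coordinate, so the union has to be
   bounded before taking sections. *)
pose C1 i := if unlift ord0 i is Some i' then C' i' else setT.
have C1E : (fun i => C1 (lift ord0 i)) = C'.
  by apply/funext => i; rewrite /C1 liftK.
have C10 n : C1 ord0 n by rewrite /C1 unlift_none.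
have iC1 i : infinite_set (C1 i).
  by rewrite /C1; case: unliftP => // _; exact: infinite_nat.
have : finpow (box C1 `&`
    [set x : k.+1.-tuple nat | exists2 i, (i <= nth 0 x p)%N & (~` V i) x]).
  apply: finpow_coord_union => // [i|i]; first exact: beyondC.
  apply/finpowSE; rewrite [X in cofinite_set X](_ : _ = setT) ?setCT //.
  rewrite -subTset => n _ /=; rewrite sect_box // C1E.
  apply: finpowS (fV i) => y [C'y /sectSE nVy]; split=> //.
  by rewrite (sect_beyond 0 n (bV i)) => /sectSE.
move=> /finpowSE; apply: sub_finite_set => n /= /contrapT fn.
rewrite sect_box // C1E => fU; apply: (box_notin_finpow iC').
apply: finpowS (finpowU fn fU) => y C'y.
have [Wy|nWy] := pselect (W [tuple of n :: y]); [left|right]; split=> //.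
- by move=> i; apply: C'C.
- by move=> /sectSE[].
- apply/sectSE; apply: contrapT => nex; apply: nWy => i ip.
  by apply: contrapT => nVi; apply: nex; exists i.
Qed.

(** * Infima and suprema in the quotient *)

Lemma coord_inter_infimum k p (V : nat -> set (k.-tuple nat)) :
  (p < k)%N -> (forall i, beyond p (V i)) ->
  infimums (range (fun n => pclass (NC_ideal k) (V n)))
    (pclass (NC_ideal k)
       [set x : k.-tuple nat | forall i, (i <= nth 0 x p)%N -> V i x]).
Proof.
move=> pk bV; split=> [_ [n _ <-]|y].
  rewrite le_pclass; apply/asboolP; apply: NCS (NC_slab n pk) => x [Wx nVx] /=.
  by rewrite ltnNge; apply/negP => /Wx.
elim/pclass_ind: y => X XV; rewrite le_pclass; apply/asboolP.
apply: NC_setD_coord_inter => // n; apply/asboolP.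
by have := XV _ (imageT _ n); rewrite le_pclass.
Qed.

Lemma coord_union_supremum k p (V : nat -> set (k.-tuple nat)) :
  (p < k)%N -> (forall i, beyond p (V i)) ->
  supremums (range (fun n => pclass (NC_ideal k) (V n)))
    (pclass (NC_ideal k)
       [set x : k.-tuple nat | exists2 i, (i <= nth 0 x p)%N & V i x]).
Proof.
move=> pk bV; split=> [_ [n _ <-]|y].
  rewrite le_pclass; apply/asboolP; apply: NCS (NC_slab n pk) => x [Vx nWx] /=.
  by rewrite ltnNge; apply/negP => np; apply: nWx; exists n.
elim/pclass_ind: y => X XV; rewrite le_pclass; apply/asboolP.
have NV n : NC (~` X `\` ~` V n).
  have := XV _ (imageT _ n); rewrite le_pclass => /asboolP.
  by apply: NCS => x [nXx /contrapT].
apply: NCS (NC_setD_coord_inter pk (fun i => beyondC (bV i)) NV).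
move=> x [[i ip Vx] nXx]; split=> // /(_ i ip); exact.
Qed.

(** * The alternating expression *)

(** Positions are given by a function [p] rather than by a set [E], so that induction on [j] can
    drop the outermost operation together with [p ord0]. *)
Definition alt_coprod (k : nat) (b : bool) (j : nat) (p : 'I_j -> nat)
    (A : j.-tuple nat -> set nat) : set (k.-tuple nat) :=
  [set x : k.-tuple nat | alt_bounded b [tuple nth 0 x (p i) | i < j] A (nth 0 x k.-1)].

Lemma alt_coprod_beyond k b j q (p : 'I_j -> nat) A :
  (q < k.-1)%N -> (forall i, (q < p i)%N) -> beyond q (@alt_coprod k b j p A).
Proof.
move=> qk qp x y xy; rewrite /alt_coprod /= (xy k.-1) //.
by under eq_mktuple do rewrite xy //.
Qed.

Lemma alt_coprodS k b j (p : 'I_j.+1 -> nat) A :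
  let V n := @alt_coprod k (~~ b) j (fun i => p (lift ord0 i))
               (fun s => A [tuple of n :: s]) in
  @alt_coprod k b j.+1 p A =
  if b then [set x : k.-tuple nat | forall i, (i <= nth 0 x (p ord0))%N -> V i x]
  else [set x : k.-tuple nat | exists2 i, (i <= nth 0 x (p ord0))%N & V i x].
Proof.
have th (x : k.-tuple nat) :
    thead [tuple nth 0 x (p i) | i < j.+1] = nth 0 x (p ord0).
  by rewrite /thead tnth_mktuple.
have bh (x : k.-tuple nat) :
    [tuple of behead [tuple nth 0 x (p i) | i < j.+1]] =
    [tuple nth 0 x (p (lift ord0 i)) | i < j].
  apply: eq_from_tnth => i; rewrite tnth_behead !tnth_mktuple.
  by congr (nth 0 x (p _)); apply: val_inj; rewrite /= inordK ?ltnS.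
move=> V; apply/seteqP; rewrite /alt_coprod.
by case: b @V => V; split=> x /=; rewrite th bh.
Qed.

Lemma alt_value_alt_coprod k b j (p : 'I_j -> nat) A :
  (forall i, (p i < k.-1)%N) ->
  (forall a b : 'I_j, (a < b)%N -> (p a < p b)%N) ->
  alt_value b (fun n => pclass (NC_ideal k) (cylinder (A n)))
    (pclass (NC_ideal k) (@alt_coprod k b j p A)).
Proof.
elim: j b p A => [|j IH] b p A pk pS //.
pose V n := @alt_coprod k (~~ b) j (fun i => p (lift ord0 i))
              (fun s => A [tuple of n :: s]).
exists (fun n => pclass (NC_ideal k) (V n)); split.
  by move=> n; apply: IH => [i|a c ac]; [exact: pk|exact: pS].
(* Since [p] increases and stays below [k.-1], the inner expressions read only coordinates after
   [p ord0]. *)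
have bV i : beyond (p ord0) (V i).
  by apply: alt_coprod_beyond => // i'; exact: pS.
have pk0 : (p ord0 < k)%N := leq_trans (pk ord0) (leq_pred k).
rewrite alt_coprodS.
by case: b @V bV => V bV; [exact: coord_inter_infimum|exact: coord_union_supremum].
Qed.

Theorem theorem3p7 (j k : nat) (hj : (1 <= j)%N) (hjk : (j < k)%N)
  (l : 'I_j -> 'I_k.-1) (hl : forall a b : 'I_j, (a < b)%N -> (l a < l b)%N)
  (A : j.-tuple nat -> set nat) (hA : forall n, infinite_set (A n)) :
  let B (m : range l -> nat) : set nat :=
    alt_bounded true [tuple m (range_elt l i) | i < j] A in
  alt_value true (fun n => pclass (NC_ideal k) (cylinder (A n)))
                 (pclass (NC_ideal k) (coprod B)).
(* [restr x (range_elt l i)] computes to [nth 0 x (l i)], so [coprod B] is convertible to the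
   [alt_coprod] of [l]. *)
Proof. exact: (@alt_value_alt_coprod k true j (fun i => l i)). Qed.
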